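(* Let $$0<\varepsilon_1<-2+\frac{\sqrt{147}}{6}.$$ Then there is a constant $\eta>0$, depending only on $\varepsilon_1$, such that the following holds. If $\varepsilon \geq 0$ and $\{x_n,x_n^*\}_{n=1}^\infty$ is a $(1+\varepsilon)$-bounded fundamental biorthogonal system in $S(\ell_1)\times\ell_\infty$ satisfying $$\sup_{n\in\mathbb N} d(x_n^*,Z_2)<\eta$$ for some subspace $Z_2$ of $\ell_\infty$ that is $(1+\eta)$-isomorphic to a Hilbert space, then $\varepsilon>\varepsilon_1$.
   Context: All Banach spaces (including the Hilbert space) are real and infinite-dimensional. $\ell_\infty=\ell_1^*$, $S(\ell_1)$ is the unit sphere of $\ell_1$, and $d(x^*,Z)$ is the norm distance from $x^*$ to $Z$. A sequence of pairs $\{x_n,x_n^*\}$ with $x_n\in S(\ell_1)$, $x_n^*\in\ell_\infty$ is a biorthogonal system if $x_n^*(x_m)=\delta_{nm}$; it is $M$-bounded if $\{x_n\}$ and $\{x_n^*\}$ are bounded and $\sup_n\|x_n\|\,\|x_n^*\|\le M$; it is fundamental if the closed linear span of $\{x_n\}$ is $\ell_1$. Two Banach spaces $X,Y$ are $\tau$-isomorphic if there is a surjective bounded linear $T:X\to Y$ and $a,b>0$ with $ab=\tau$ and $a^{-1}\|x\|\le\|Tx\|\le b\|x\|$ for all $x\in X$. *)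

(* Defs.v *)
From HB Require Import structures.
From mathcomp Require Import all_boot all_order all_algebra.
From mathcomp Require Import sesquilinear.
From mathcomp Require Import boolp classical_sets functions reals ereal.
From mathcomp Require Import topology normedtype sequences.

Set Implicit Arguments.
Unset Strict Implicit.
Unset Printing Implicit Defensive.

Import Order.TTheory GRing.Theory Num.Theory.
Import numFieldNormedType.Exports.

Local Open Scope classical_set_scope.
Local Open Scope ring_scope.

Definition abs_series (R : realType) (u : nat -> R^o) : nat -> R :=
  series (fun k => `|u k| : R).

Definition is_l1 (R : realType) : {pred nat -> R^o} :=
  mem [set u : nat -> R^o | cvgn (abs_series u)].

Record l1 (R : realType) := L1 { l1_val :> nat -> R^o; _ : l1_val \in @is_l1 R }.

Section l1_structure.
Variable R : realType.
Implicit Types u v : nat -> R^o.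

Lemma is_l1E u : (u \in @is_l1 R) = `[< cvgn (abs_series u) >].
Proof. by apply/idP/asboolP; rewrite inE. Qed.

Fact is_l1_submod : submod_closed (@is_l1 R).
Proof.
split=> [|a u v]; rewrite !is_l1E.
  apply/asboolP; rewrite (_ : abs_series _ = fun=> 0); first exact: is_cvg_cst.
  by apply/funext => n; rewrite /abs_series/series/= big1// => i _; exact: normr0.
move=> /asboolP cu /asboolP cv; apply/asboolP.
apply: (@series_le_cvg _ _ ((fun k => `|a| *: `|u k|) + (fun k => `|v k|))).
- by move=> n /=.
- by move=> n /=; rewrite addr_ge0// mulr_ge0.
- by move=> n /=; rewrite (le_trans (ler_normD _ _))// normrZ.
- by apply: is_cvg_seriesD => //; exact: is_cvg_seriesZ.
Qed.

HB.instance Definition _ :=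
  GRing.isSubmodClosed.Build R (nat -> R^o) (@is_l1 R) is_l1_submod.
HB.instance Definition _ := [isSub for @l1_val R].
HB.instance Definition _ := [Choice of l1 R by <:].
HB.instance Definition _ := [SubChoice_isSubLmodule of l1 R by <:].

Definition l1_norm (x : l1 R) : R := limn (abs_series x).

Lemma l1_cvg (x : l1 R) : cvgn (abs_series x).
Proof. by move: (valP x); rewrite is_l1E => /asboolP. Qed.

Fact l1_normD (x y : l1 R) : l1_norm (x + y) <= l1_norm x + l1_norm y.
Proof.
rewrite /l1_norm -limD; [|exact: l1_cvg|exact: l1_cvg].
apply: ler_lim; [exact: l1_cvg|by apply: is_cvgD; exact: l1_cvg|].
apply: nearW => n.
rewrite (_ : (_ + _) n = abs_series x n + abs_series y n)// -big_split/=.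
by apply: ler_sum => i _; exact: ler_normD.
Qed.

Fact l1_normZ (a : R) (x : l1 R) : l1_norm (a *: x) = `|a| * l1_norm x.
Proof.
rewrite /l1_norm.
have -> : abs_series (a *: x : l1 R) = `|a| *: (abs_series x).
  by rewrite -seriesZ; congr series; apply/funext => k; exact: normrZ.
by rewrite limZl_tmp//; exact: l1_cvg.
Qed.

Fact l1_norm_eq0 (x : l1 R) : l1_norm x = 0 -> x = 0.
Proof.
move=> x0; apply/val_inj/funext => k /=.
have nd : nondecreasing_seq (abs_series x).
  by apply: nondecreasing_series => n _ _; exact: normr_ge0.
have := nondecreasing_cvgn_le nd (@l1_cvg x) k.+1.
rewrite -/(l1_norm x) x0 /abs_series/series/= big_nat_recr//= => h.
apply/normr0_eq0/eqP; rewrite eq_le normr_ge0 andbT.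
by apply: le_trans h; rewrite lerDr sumr_ge0.
Qed.

HB.instance Definition _ :=
  Lmodule_isNormed.Build R (l1 R) l1_normD l1_normZ l1_norm_eq0.

Lemma l1_normE (x : l1 R) : `|x| = limn (series (fun k => `|x k| : R)).
Proof. by []. Qed.
End l1_structure.

Definition is_linf (R : realType) : {pred nat -> R^o} :=
  mem [set u : nat -> R^o | bounded_fun u].

Record linf (R : realType) :=
  Linf { linf_val :> nat -> R^o; _ : linf_val \in @is_linf R }.

Section linf_structure.
Variable R : realType.
Implicit Types u v : nat -> R^o.

Lemma is_linfP u : reflect (exists M, forall k, `|u k| <= M) (u \in @is_linf R).
Proof.
have T : ProperFilter (globally [set: nat]) := globally_properfilter (a := 0%N) I.
apply: (iffP idP); rewrite inE.
  by move=> /ex_bound[M uM]; exists M => k; exact: uM.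
by move=> [M uM]; apply/ex_bound; exists M => k _; exact: uM.
Qed.

Fact is_linf_submod : submod_closed (@is_linf R).
Proof.
split=> [|a u v]; first by apply/is_linfP; exists 0 => k; rewrite normr0.
move=> /is_linfP[M uM] /is_linfP[N vN]; apply/is_linfP; exists (`|a| * M + N) => k.
by rewrite (le_trans (ler_normD _ _))// lerD// normrZ ler_wpM2l.
Qed.

HB.instance Definition _ :=
  GRing.isSubmodClosed.Build R (nat -> R^o) (@is_linf R) is_linf_submod.
HB.instance Definition _ := [isSub for @linf_val R].
HB.instance Definition _ := [Choice of linf R by <:].
HB.instance Definition _ := [SubChoice_isSubLmodule of linf R by <:].

Definition linf_norm (f : linf R) : R := sup (range (fun k => `|f k|)).

Lemma linf_has_sup (f : linf R) : has_sup (range (fun k => `|f k|)).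
Proof.
split; first by exists `|f 0|; exists 0.
by have /is_linfP[M fM] := valP f; exists M => _ [k _ <-]; exact: fM.
Qed.

Lemma linf_norm_ub (f : linf R) k : `|f k| <= linf_norm f.
Proof. by apply: (ub_le_sup (linf_has_sup f).2); exists k. Qed.

Lemma linf_norm_le (f : linf R) M : (forall k, `|f k| <= M) -> linf_norm f <= M.
Proof.
by move=> fM; apply: ge_sup; [exact: (linf_has_sup f).1|move=> _ [k _ <-]; exact: fM].
Qed.

Fact linf_normD (f g : linf R) : linf_norm (f + g) <= linf_norm f + linf_norm g.
Proof.
apply: linf_norm_le => k; rewrite (le_trans (ler_normD _ _))//.
by rewrite lerD// linf_norm_ub.
Qed.

Fact linf_normZ (a : R) (f : linf R) : linf_norm (a *: f) = `|a| * linf_norm f.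
Proof.
have le b g : linf_norm (b *: g) <= `|b| * linf_norm g.
  apply: linf_norm_le => k.
  by rewrite (_ : (b *: g) k = b *: g k)// normrZ ler_wpM2l// linf_norm_ub.
apply/eqP; rewrite eq_le le/=.
have [->|a0] := eqVneq a 0.
  by rewrite normr0 mul0r (le_trans _ (linf_norm_ub _ 0)).
rewrite -[in leLHS](scalerK a0 f) (le_trans (ler_wpM2l _ (le _ _)))//.
by rewrite mulrA -normrM divff// normr1 mul1r.
Qed.

Fact linf_norm_eq0 (f : linf R) : linf_norm f = 0 -> f = 0.
Proof.
move=> f0; apply/val_inj/funext => k /=; apply/normr0_eq0/eqP.
by rewrite eq_le normr_ge0 andbT -f0 linf_norm_ub.
Qed.

HB.instance Definition _ :=
  Lmodule_isNormed.Build R (linf R) linf_normD linf_normZ linf_norm_eq0.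

Lemma linf_normE (f : linf R) : `|f| = sup (range (fun k => `|f k|)).
Proof. by []. Qed.
End linf_structure.

(* The identification of linf with the dual of l1: f acts on x by
   f(x) = \sum_k f_k x_k, a series that converges absolutely. *)
Definition dual_pairing (R : realType) (f : linf R) (x : l1 R) : R :=
  limn (series (fun k => f k * x k)).

Lemma is_cvg_dual_pairing (R : realType) (f : linf R) (x : l1 R) :
  cvgn (series (fun k => f k * x k : R^o)).
Proof.
apply: normed_cvg.
apply: (@series_le_cvg _ _ (fun k => linf_norm f *: `|x k|)).
- by move=> n /=.
- by move=> n; rewrite mulr_ge0// (le_trans _ (linf_norm_ub f 0)).
- by move=> n /=; rewrite normrM ler_wpM2r// linf_norm_ub.
- by apply: is_cvg_seriesZ; exact: l1_cvg.
Qed.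

Definition biorthogonal (R : realType) (x : nat -> l1 R) (xs : nat -> linf R) :=
  forall n m, dual_pairing (xs n) (x m) = (n == m)%:R.

Definition M_bounded (R : realType) (X Y : normedModType R)
    (x : nat -> X) (xs : nat -> Y) (M : R) :=
  [/\ bounded_fun x, bounded_fun xs &
      (ereal_sup (range (fun n => (`|x n| * `|xs n|)%:E)) <= M%:E)%E].

Definition linear_span (R : realType) (X : normedModType R) (x : nat -> X) :
    set X :=
  [set y | exists n (c : 'I_n -> R), y = \sum_(k < n) c k *: x k].

Definition fundamental (R : realType) (X : normedModType R) (x : nat -> X) :=
  closure (linear_span x) = setT.

Definition dist_to (R : realType) (X : normedModType R) (x : X) (Z : set X) :
    \bar R :=
  ereal_inf [set `|x - z|%:E | z in Z].

Definition linear_subspace (R : realType) (X : lmodType R) (Z : set X) :=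
  Z 0 /\ forall (a : R) (u v : X), Z u -> Z v -> Z (a *: u + v).

Definition infinite_dimensional (R : realType) (X : lmodType R) :=
  forall n (v : 'I_n -> X),
    exists y : X, forall c : 'I_n -> R, y <> \sum_(k < n) c k *: v k.

Definition hilbert_space (R : realType) (H : completeNormedModType R) :=
  infinite_dimensional H /\
  exists dot : {dot H for @idfun R}, forall u : H, dot u u = `|u| ^+ 2.

(* T is only meaningful on Z, where it is a linear bijection onto Y; its values
   outside Z are unconstrained. *)
Definition tau_isomorphic (R : realType) (X : normedModType R) (Z : set X)
    (Y : normedModType R) (tau : R) :=
  exists (T : X -> Y) (a b : R),
    [/\ 0 < a, 0 < b & a * b = tau] /\
    [/\ forall (c : R) (u v : X), Z u -> Z v -> T (c *: u + v) = c *: T u + T v,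
        T @` Z = setT &
        forall u : X, Z u -> a^-1 * `|u| <= `|T u| <= b * `|u|].

(* Main.v *)
(* Put [C_n = {k : |x_n^*(k)| >= 0.91}]. As [x_n^*(x_n) = 1] and
   [|x_n^*| <= 1 + eps], the unit vector [x_n] carries at least half of its mass
   on [C_n]. If the [C_n] are pairwise disjoint and miss some [j], then
   [|e_j - \sum_n c_n x_n| >= 1] for all [c]: on [C_n] the mass of [c_n x_n]
   outweighs whatever it can cancel elsewhere. So the [x_n] are not fundamental.

   Biorthogonality and [|x_n| = 1] give [|x_n^* + t x_m^*| >= 1] for all [t], so
   nearby vectors [f_n] of the almost Hilbert space [Z2] are almost orthonormal
   when [eps] is small. Then [f_n] and [f_m] cannot both be close to 1 in absolute
   value at a same [k], since [|f_n +- f_m|] is about [sqrt 2 < 2], so the [C_n]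
   are disjoint. For [j] take a coordinate almost norming [f_0 +- f_1], with the
   sign making the inner product of [f_0] and [+- f_1] nonpositive: in the Hilbert
   norm, evaluation at [j] is almost the inner product with the normalization of
   [f_0 +- f_1], about [1 / sqrt 2] at most on each [f_n]. The bounds on
   [eps1] leave enough room for [eta = 1/1000]. *)
Require Import Defs.
From mathcomp Require Import all_boot all_order all_algebra.
From mathcomp Require Import boolp classical_sets functions reals ereal.
From mathcomp Require Import topology normedtype sequences.
From mathcomp Require Import sesquilinear ring lra.

Set Implicit Arguments.
Unset Strict Implicit.
Unset Printing Implicit Defensive.

Import Order.TTheory GRing.Theory Num.Theory.
Import numFieldNormedType.Exports.

Local Open Scope classical_set_scope.
Local Open Scope ring_scope.

(** * Pairing and unit vectors in [l1] *)

Lemma dual_pairing_le (R : realType) (f : linf R) (x : l1 R) :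
  `|dual_pairing f x| <= `|f| * `|x|.
Proof.
have cx : cvgn (series (fun k => `|f| *: (`|x k| : R^o))).
  by apply: is_cvg_seriesZ; exact: l1_cvg.
have le k : `|f k * x k| <= `|f| *: (`|x k| : R^o).
  by rewrite normrM ler_wpM2r// linf_norm_ub.
have cn : cvgn [normed series (fun k => f k * x k : R^o)].
  by apply: (series_le_cvg _ _ le cx) => k; [exact: normr_ge0|exact: (le_trans (normr_ge0 _) (le k))].
apply: (le_trans (lim_series_norm cn)).
apply: (le_trans (lim_series_le cn cx le)).
rewrite le_eqVlt; apply/orP; left; apply/eqP.
by rewrite lim_seriesZ//; exact: l1_cvg.
Qed.

Lemma dual_pairingDZ (R : realType) (f g : linf R) (t : R) (x : l1 R) :
  dual_pairing (f + t *: g) x = dual_pairing f x + t * dual_pairing g x.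
Proof.
rewrite /dual_pairing.
have cf := @is_cvg_dual_pairing _ f x.
have cg := @is_cvg_dual_pairing _ g x.
have := lim_seriesD cf (is_cvg_seriesZ (k := t) cg).
rewrite lim_seriesZ// => <-; congr (limn (series _)).
by apply/funext => k; rewrite [LHS]mulrDl -mulrA.
Qed.

Section unit_vector.
Variables (R : realType) (j : nat).

Let delta : nat -> R^o := fun k => (k == j)%:R.

Fact l1_delta_subproof : delta \in @is_l1 R.
Proof.
rewrite is_l1E; apply/asboolP.
apply: (@is_cvg_near_cst _ _ (1 : R^o)).
near=> K; rewrite /abs_series/series/=.
rewrite (bigD1_seq j)/= ?iota_uniq// ?mem_index_iota/=; last by near: K; exists j.+1.
rewrite /delta eqxx normr1 big1 ?addr0// => i /negbTE ->.
exact: normr0.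
Unshelve. all: by end_near. Qed.

Definition l1_delta : l1 R := L1 l1_delta_subproof.

Lemma l1_deltaE k : l1_delta k = (k == j)%:R. Proof. by []. Qed.
End unit_vector.

(** * A criterion for a sequence in [l1] not to be fundamental *)

Lemma partial_sum_le_l1 (R : realType) (z : l1 R) K :
  \sum_(0 <= k < K) `|z k| <= `|z|.
Proof.
rewrite l1_normE; apply: (@nondecreasing_cvgn_le R (series (fun k => `|z k| : R))).
  by apply: nondecreasing_series => n _ _; exact: normr_ge0.
exact: l1_cvg.
Qed.

(** The factor [(-1) ^+ (~~ C n k)] is 1 on [C n] and -1 off it. Dominance is asked of partial sums,
    so that the estimate stays finite. *)
Lemma disjoint_dominant_not_fundamental (R : realType) (x : nat -> l1 R)
    (C : nat -> pred nat) (j : nat) :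
  (forall n m k, C n k -> C m k -> n = m) ->
  (forall n, \forall K \near \oo,
    0 <= \sum_(0 <= k < K) `|x n k| * (-1) ^+ (~~ C n k)) ->
  (forall n, ~~ C n j) -> ~ fundamental x.
Proof.
move=> Cdisj Cdom Cj fx.
have : closure (linear_span x) (l1_delta R j) by rewrite fx.
move=> /(_ _ (nbhsx_ballx _ _ ltr01))[_ [[N [c ->]]]].
rewrite -ball_normE /=; apply/negP; rewrite -leNgt.
set z := (z in `|z|).
have zE k : z k = (k == j)%:R - \sum_(n < N) c n * x n k.
  rewrite /z -[RHS]/(_ - _).
  rewrite -l1_deltaE.
  have -> : (\sum_(n < N) c n * x n k) = (\sum_(n < N) c n *: x n : l1 R) k.
    have -> : l1_val (\sum_(n < N) c n *: x n) = \sum_(n < N) l1_val (c n *: x n).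
      exact: (raddf_sum (val : l1 R -> (nat -> R^o))).
    by rewrite fct_sumE.
  by [].
(* On [C n] the triangle inequality isolates term [n], the others counting as losses; elsewhere, in
   particular at [j], every term is a loss. Summing over [k] leaves the 1 at [j] plus nonnegative
   sums. *)
have pt k : (k == j)%:R + \sum_(n < N) `|c n| * (`|x n k| * (-1) ^+ (~~ C n k)) <= `|z k|.
  rewrite zE.
  have [[n Cnk]|nC] := pselect (exists n : 'I_N, C n k).
    have kj : (k == j) = false by apply/eqP => kj; have := Cj n; rewrite -kj Cnk.
    rewrite kj add0r sub0r normrN (bigD1 n)//= [in leRHS](bigD1 n)//= Cnk expr0 mulr1.
    rewrite addrC -[leLHS]opprK opprD -sumrN -normrM.
    set s := \sum_(i < N | i != n) c i * x i k.
    have : `|s| <= \sum_(i < N | i != n) - (`|c i| * (`|x i k| * (-1) ^+ (~~ C i k))).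
      apply: le_trans (ler_norm_sum _ _ _) _; apply: ler_sum => i ni.
      have -> : C i k = false.
        by apply/negP => Cik; move/negP: ni; apply; apply/eqP/val_inj/(Cdisj _ _ k).
      by rewrite expr1 mulrN1 mulrN opprK normrM.
    have := ler_normB (c n * x n k + s) s; rewrite addrK.
    lra.
  have -> : \sum_(n < N) `|c n| * (`|x n k| * (-1) ^+ (~~ C n k)) =
            - \sum_(n < N) `|c n * x n k|.
    rewrite -sumrN; apply: eq_bigr => n _.
    have -> : C n k = false by apply/negP => Cnk; apply: nC; exists n.
    by rewrite expr1 mulrN1 mulrN normrM.
  apply: le_trans (lerB_dist _ _); rewrite ger0_norm ?ler0n// lerD2l lerN2.
  exact: ler_norm_sum.
have : \forall K \near \oo, forall n : 'I_N,
    0 <= \sum_(0 <= k < K) `|x n k| * (-1) ^+ (~~ C n k).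
  by apply: filter_forall => n; exact: Cdom.
move=> [K0 _ HK].
(* The partial sum has to include coordinate [j]. *)
pose K := maxn K0 j.+1.
have {}HK := HK K (leq_maxl _ _).
apply: le_trans (partial_sum_le_l1 z K).
apply: (@le_trans _ _ (\sum_(0 <= k < K) ((k == j)%:R +
   \sum_(n < N) `|c n| * (`|x n k| * (-1) ^+ (~~ C n k))))); last exact: ler_sum.
rewrite big_split/= exchange_big/= (bigD1_seq j)/= ?iota_uniq//; last first.
  by rewrite mem_index_iota/= leq_maxr.
rewrite eqxx [X in _ + X + _]big1 => [|i /negbTE ->//].
rewrite addr0 lerDl; apply: sumr_ge0 => n _.
by rewrite -mulr_sumr mulr_ge0.
Qed.

(* Where [|f k| < c] the weight against [|x k|] is below the midpoint
   [(c + M) / 2 < 1], so the coordinates with [c <= |f k|] must carry at least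
   half of the mass of [x] for the pairing to reach 1. *)
Lemma dominant_coordinates (R : realType) (f : linf R) (x : l1 R) (c M : R) :
  0 <= c -> c < M -> c + M < 2 -> `|f| <= M -> `|x| <= 1 -> dual_pairing f x = 1 ->
  \forall K \near \oo,
    0 <= \sum_(0 <= k < K) `|x k| * (-1) ^+ (~~ (c <= `|f k|)).
Proof.
move=> c0 cM cM2 fM x1 fx.
have h1 : (c + M) / 2 < 1 by lra.
have /cvgr_gt/(_ _ h1) : series (fun k => f k * x k : R^o) @ \oo --> (1 : R^o).
  by rewrite -fx; exact: is_cvg_dual_pairing.
apply: filterS => K; rewrite /series/= => hK.
(* The right side is [M * |x k|] where [c <= |f k|], and [c * |x k|] elsewhere. *)
have pt k : f k * x k <=
    (c + M) / 2 * `|x k| + (M - c) / 2 * (`|x k| * (-1) ^+ (~~ (c <= `|f k|))).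
  apply: le_trans (ler_norm _) _; rewrite normrM.
  have := normr_ge0 (x k); have := le_trans (linf_norm_ub f k) fM.
  case: (leP c `|f k|) => /= ; rewrite ?expr0 ?expr1; nra.
have : (\sum_(0 <= k < K) f k * x k <= (c + M) / 2 * \sum_(0 <= k < K) `|x k| +
   (M - c) / 2 * \sum_(0 <= k < K) (`|x k| * (-1) ^+ (~~ (c <= `|f k|))))%R.
  rewrite !mulr_sumr -big_split/=; apply: ler_sum => k _; exact: pt.
have := partial_sum_le_l1 x K.
have : 0 <= \sum_(0 <= k < K) `|x k| by apply: sumr_ge0.
move: hK.
set a := \sum_(_ <= _ < _) _; set b := \sum_(_ <= _ < _) _; set d := \sum_(_ <= _ < _) _.
move=> *; nra.
Qed.

(** * Inner products, signs and the final numerical estimate *)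

Lemma dot_normDZ (R : realType) (H : normedModType R) (dot : {dot H for @idfun R})
    (u v : H) (t : R) : (forall w : H, dot w w = `|w| ^+ 2) ->
  `|u + t *: v| ^+ 2 = `|u| ^+ 2 + 2 * t * dot u v + t ^+ 2 * `|v| ^+ 2.
Proof.
move=> dotE; rewrite -!dotE linearDl !linearDr !linearZl_LR !linearZr_LR/=.
rewrite /idfun/= [dot v u]hermC expr0 mul1r/= /idfun /GRing.scale/=.
ring.
Qed.

Lemma sign_align (R : realDomainType) (a b : R) :
  exists e : bool, `|a + (-1) ^+ e * b| = `|a| + `|b|.
Proof.
exists ((a < 0) (+) (b < 0)); rewrite {1}[a]realEsign ?num_real//.
rewrite {2}[b]realEsign ?num_real// mulrA -signr_addb addbK -mulrDr.
by rewrite normrMsign ger0_norm// addr_ge0.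
Qed.

(* [N] is the Hilbert norm of [u = f 0 +- f 1], where [f 0], [f 1] have squared
   norms [A0], [A1] and inner product [+- q]; [a] is the absolute value of a
   coordinate of [u] nearly attaining its sup norm [U]; [b] is that of some
   [f m], of squared norm [A] and inner product [+- d] with [u]. *)
Lemma no_third_peak (R : realFieldType) (N U a b d q A A0 A1 : R) : 0 <= N ->
  998 / 1000 <= A0 -> 998 / 1000 <= A1 ->
  A0 <= 105 / 100 -> A1 <= 105 / 100 -> A <= 105 / 100 ->
  - (1 / 4) <= q -> q <= 0 -> N ^+ 2 = A0 + 2 * q + A1 ->
  N <= 1001 / 1000 * U -> U - 1 / 1000 <= a -> 9 / 10 <= b ->
  d <= 105 / 100 + q -> (a + b) ^+ 2 <= N ^+ 2 + 2 * d + A -> False.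
Proof.
move=> N0 A0ge A1ge A0le A1le Ale q1 q0 NE NU Ua b9 dq h.
have N_ge : 122 / 100 <= N by nra.
have N_le : N <= 145 / 100 by nra.
have ab : 999 / 1000 * N + 899 / 1000 <= a + b by lra.
have : (999 / 1000 * N + 899 / 1000) ^+ 2 <= (a + b) ^+ 2.
  by clear -ab N0; nra.
(* Eliminating [d] and [q] leaves a convex quadratic in [N], negative at both ends of the interval;
   bounding [N ^+ 2] by its chord makes the problem linear. *)
have : 0 <= (N - 122 / 100) * (145 / 100 - N) by clear -N_ge N_le; nra.
by clear -h NE dq A0ge A1ge Ale N_le N_ge; lra.
Qed.

(** * Almost orthonormal sequences in an almost Hilbert subspace *)

Section almost_orthonormal.
Variables (R : realType) (Z : set (linf R)) (H : normedModType R).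
Variables (dot : {dot H for @idfun R}) (T : linf R -> H) (f : nat -> linf R).
Hypothesis dotE : forall w : H, dot w w = `|w| ^+ 2.
Hypothesis ZDZ : forall (t : R) u v, Z u -> Z v -> Z (u + t *: v).
Hypothesis TDZ : forall (t : R) u v, Z u -> Z v -> T (u + t *: v) = T u + t *: T v.
Hypothesis T_ge : forall u, Z u -> `|u| <= `|T u|.
Hypothesis T_le : forall u, Z u -> `|T u| <= 1001 / 1000 * `|u|.
Hypothesis fZ : forall n, Z (f n).
Hypothesis f_le : forall n, `|f n| <= 1022 / 1000.
Hypothesis f_ge : forall n m (t : R), n != m ->
  1 - (1 + `|t|) / 1000 <= `|f n + t *: f m|.

(** Evaluation at [k] is bounded by the sup norm, hence by the Hilbert norm. *)
Let T_comb_ge (t : R) u v k : Z u -> Z v ->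
  `|u k + t * v k| ^+ 2 <=
  `|T u| ^+ 2 + 2 * t * dot (T u) (T v) + t ^+ 2 * `|T v| ^+ 2.
Proof.
move=> Zu Zv; rewrite -(dot_normDZ _ _ _ dotE) -TDZ//.
rewrite ler_sqr ?nnegrE ?normr_ge0//.
exact: le_trans (linf_norm_ub (u + t *: v) k) (T_ge (ZDZ t Zu Zv)).
Qed.

Let Tf_sq_le n : `|T (f n)| ^+ 2 <= 105 / 100.
Proof.
have := T_le (fZ n); have := f_le n; have := normr_ge0 (T (f n)).
set a := `|T _|; set b := `|f n|; nra.
Qed.

Let Tf_sq_ge n : 998 / 1000 <= `|T (f n)| ^+ 2.
Proof.
have := T_ge (fZ n); have := @f_ge n n.+1 0; rewrite neq_ltn ltnSn
  scale0r addr0 normr0 => /(_ isT).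
set a := `|T _|; set b := `|f n|; nra.
Qed.

(** A large inner product would push some [f n + t *: f m] well below norm 1, against [f_ge]. Taking
    [t = +- 1/5], nearly optimal, gives the bound (1.05 + 0.042 - 0.997) / 0.4 = 0.2375. *)
Let Tf_dot_le n m : n != m -> `|dot (T (f n)) (T (f m))| <= 1 / 4.
Proof.
move=> nm.
have P (t : R) : (1 - (1 + `|t|) / 1000) <= 
  `|T (f n) + t *: T (f m)|.
  by rewrite -TDZ//; apply: le_trans (f_ge t nm) (T_ge (ZDZ t (fZ n) (fZ m))).
have Q (t : R) : `|t| = 1 / 5 -> 997 / 1000 <=
    `|T (f n)| ^+ 2 + 2 * t * dot (T (f n)) (T (f m)) + t ^+ 2 * `|T (f m)| ^+ 2.
  move=> t5; rewrite -(dot_normDZ _ _ _ dotE).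
  have := P t; rewrite t5 => Pt.
  have {}Pt : 9988 / 10000 <= `|T (f n) + t *: T (f m)| by apply: le_trans Pt; lra.
  by rewrite expr2; nra.
have n5 : `|1 / 5 : R| = 1 / 5 by rewrite ger0_norm//; lra.
have h1 := Q _ n5; have := Q (- (1 / 5)); rewrite normrN => /(_ n5) h2.
have := Tf_sq_le n; have := Tf_sq_le m; rewrite ler_norml => h3 h4.
apply/andP; split; lra.
Qed.

(** With signs aligned, two peaks at [k] would give 1.8^2 = 3.24 <= 1.05 + 1.05 + 2/4 = 2.6. *)
Lemma peaks_disjoint n m k :
  9 / 10 <= `|f n k| -> 9 / 10 <= `|f m k| -> n = m.
Proof.
move=> hn hm; apply/eqP/negPn/negP => nm.
have [e eE] := sign_align (f n k) (f m k).
have := T_comb_ge ((-1) ^+ e) k (fZ n) (fZ m); rewrite eE sqrr_sign.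
have := Tf_dot_le nm; have := Tf_sq_le n; have := Tf_sq_le m.
rewrite ler_norml => hA hB /andP[hd1 hd2].
by case: (e); rewrite /= ?expr0 ?expr1 => h; nra.
Qed.

Lemma peaks_not_covering : exists j, forall n, `|f n j| < 9 / 10.
Proof.
pose p := dot (T (f 0)) (T (f 1)).
pose s : R := (-1) ^+ (0 < p)%R.
have s2 : s ^+ 2 = 1 by exact: sqrr_sign.
have sp : s * p <= 0.
  by rewrite /s; case: ltP => p0; rewrite ?expr0 ?expr1; lra.
have sp_ge : - (1 / 4) <= s * p.
  by rewrite lerNl (le_trans (ler_norm _))// normrN normrMsign Tf_dot_le.
pose u := f 0 + s *: f 1.
have Zu : Z u by exact: ZDZ.
have uE : `|T u| ^+ 2 = `|T (f 0)| ^+ 2 + 2 * (s * p) + `|T (f 1)| ^+ 2.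
  by rewrite TDZ// (dot_normDZ _ _ _ dotE) s2 mul1r mulrA.
have [_ [j _ <-] uj] : exists2 e, range (fun k => `|u k|) e & `|u| - 1 / 1000 < e.
  by apply: sup_adherent; [lra|exact: linf_has_sup].
exists j => m; rewrite ltNge; apply/negP => mj.
(* For [m] = 0, 1 the inner product is, up to sign, the squared norm of [T (f m)] plus [s * p]; for
   other [m] it is at most 1/2 < 1.05 - 1/4. *)
have um : `|dot (T u) (T (f m))| <= 105 / 100 + s * p.
  rewrite TDZ// linearDl linearZl_LR/=.
  case: m {mj} => [|[|m]].
  - rewrite dotE [dot (T (f 1)) _]hermC expr0 mul1r /= -/p.
    have := Tf_sq_le 0; have := Tf_sq_ge 0.
    by rewrite ler_norml => *; apply/andP; split; lra.
  - rewrite dotE -/p.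
    have -> : p = s * (s * p) by rewrite mulrA -expr2 s2 mul1r.
    rewrite -mulrDr normrMsign mulrA -expr2 s2 mul1r.
    have := Tf_sq_le 1; have := Tf_sq_ge 1.
    by rewrite ler_norml => *; apply/andP; split; lra.
  - apply: le_trans (ler_normD _ _) _; rewrite normrMsign.
    have := @Tf_dot_le 0 m.+2 isT; have := @Tf_dot_le 1 m.+2 isT; lra.
have [e eE] := sign_align (u j) (f m j).
have := T_comb_ge ((-1) ^+ e) j Zu (fZ m); rewrite eE sqrr_sign mul1r => h.
have {}um : (-1) ^+ e * dot (T u) (T (f m)) <= 105 / 100 + s * p.
  by apply: le_trans (ler_norm _) _; rewrite normrMsign.
rewrite -mulrA in h.
have U0 : `|T u| <= 1001 / 1000 * `|u| := T_le Zu.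
exact: (no_third_peak (normr_ge0 _) (Tf_sq_ge 0) (Tf_sq_ge 1) (Tf_sq_le 0)
  (Tf_sq_le 1) (Tf_sq_le m) sp_ge sp uE U0 (ltW uj) mj um h).
Qed.
End almost_orthonormal.

(** * Choice of constants and conclusion *)

Theorem corollary24 (R : realType) (eps1 : R)
    (heps1_gt0 : 0 < eps1)
    (heps1_lt : eps1 < - 2%:R + Num.sqrt 147%:R / 6%:R) :
  exists2 eta : R, 0 < eta &
    forall (eps : R) (x : nat -> l1 R) (xs : nat -> linf R)
      (Z2 : set (linf R)) (H : completeNormedModType R),
      0 <= eps ->
      (forall n, `|x n| = 1) ->
      biorthogonal x xs ->
      M_bounded x xs (1 + eps) ->
      fundamental x ->
      linear_subspace Z2 ->
      hilbert_space H ->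
      tau_isomorphic Z2 H (1 + eta) ->
      (ereal_sup (range (fun n => dist_to (xs n) Z2)) < eta%:E)%E ->
      eps1 < eps.
Proof.
exists (1 / 1000); first by lra.
move=> eps x xs Z2 H eps0 x1 bio [_ _ xsM] fx [_ ZZ] [_ [dot dotE]].
move=> [T0 [a [b [[a0 b0 ab] [T0lin _ T0b]]]]] dist.
rewrite ltNge; apply/negP => eps_le.
(* The bound on [eps1] is about 0.0207. *)
have eps_small : eps <= 21 / 1000.
  have : Num.sqrt 147%:R <= 12126 / 1000 :> R.
    have : Num.sqrt 147%:R ^+ 2 = 147 :> R by rewrite sqr_sqrtr ?ler0n.
    have := sqrtr_ge0 (147%:R : R).
    by set r := Num.sqrt _; clear; nra.
  by move: eps_le heps1_lt; lra.
have {}xsM n : `|xs n| <= 1021 / 1000.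
  have : ((`|x n| * `|xs n|)%:E <= (1 + eps)%:E)%E.
    by apply: le_trans xsM; apply: ereal_sup_ubound; exists n.
  by rewrite lee_fin x1 mul1r => /le_trans; apply; lra.
have xs_ge n m (t : R) : n != m -> 1 <= `|xs n + t *: xs m|.
  move=> nm; have := dual_pairing_le (xs n + t *: xs m) (x n).
  rewrite x1 mulr1 dual_pairingDZ !bio eqxx eq_sym (negbTE nm) mulr0 addr0.
  by rewrite normr1.
have /choice[f fP] n : exists f, Z2 f /\ `|xs n - f| < 1 / 1000.
  have : (dist_to (xs n) Z2 < (1 / 1000)%:E)%E.
    by apply: le_lt_trans dist; apply: ereal_sup_ubound; exists n.
  by move=> /ereal_inf_lt[_ [z Zz <-]]; rewrite lte_fin => hz; exists z.
have fZ n : Z2 (f n) by have [] := fP n.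
have {fP} f_close n : `|xs n - f n| <= 1 / 1000 by have [_ /ltW] := fP n.
have f_le n : `|f n| <= 1022 / 1000.
  have := ler_normB (xs n) (xs n - f n); rewrite opprB addrC subrK.
  by have := f_close n; have := xsM n; lra.
have f_ge n m (t : R) : n != m -> 1 - (1 + `|t|) / 1000 <= `|f n + t *: f m|.
  move=> nm; have := xs_ge n m t nm.
  have -> : xs n + t *: xs m = (f n + t *: f m) + ((xs n - f n) + t *: (xs m - f m)).
    by rewrite scalerBr addrACA !subrKC.
  have := ler_normD (f n + t *: f m) ((xs n - f n) + t *: (xs m - f m)).
  have := ler_normD (xs n - f n) (t *: (xs m - f m)); rewrite normrZ.
  have := f_close n; have := ler_wpM2l (normr_ge0 t) (f_close m).
  lra.
have ZDZ (t : R) u v : Z2 u -> Z2 v -> Z2 (u + t *: v).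
  by move=> Zu Zv; rewrite addrC; exact: ZZ.
(* Rescaling by [a] turns the constants [a^-1] and [b] into 1 and [a * b = 1 + eta]. *)
pose T u := a *: T0 u.
have TDZ (t : R) u v : Z2 u -> Z2 v -> T (u + t *: v) = T u + t *: T v.
  move=> Zu Zv; rewrite /T addrC T0lin// addrC scalerDr; congr (_ + _).
  by rewrite !scalerA mulrC.
have T_ge u : Z2 u -> `|u| <= `|T u|.
  move=> /T0b/andP[h _]; rewrite normrZ gtr0_norm//.
  by rewrite mulrC -ler_pdivrMr// mulrC.
have T_le u : Z2 u -> `|T u| <= 1001 / 1000 * `|u|.
  move=> /T0b/andP[_ h]; rewrite normrZ gtr0_norm//.
  have -> : 1001 / 1000 = a * b by rewrite ab; lra.
  by rewrite -mulrA ler_pM2l.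
(* The threshold 0.91 survives the error 1/1000 as 0.9, and 0.91 + 1.021 < 2, as
   [dominant_coordinates] requires. *)
have fk n k : 91 / 100 <= `|xs n k| -> 9 / 10 <= `|f n k|.
  have := le_trans (linf_norm_ub (xs n - f n) k) (f_close n).
  have := ler_normD (f n k) (xs n k - f n k); rewrite subrKC.
  have -> : (xs n - f n) k = xs n k - f n k by [].
  lra.
have [j jP] := peaks_not_covering dotE ZDZ TDZ T_ge T_le fZ f_le f_ge.
apply: (@disjoint_dominant_not_fundamental _ x (fun n k => 91 / 100 <= `|xs n k|) j) fx.
- move=> n m k /fk hn /fk hm.
  exact: (peaks_disjoint dotE ZDZ TDZ T_ge T_le fZ f_le f_ge hn hm).
- move=> n; apply: (@dominant_coordinates _ _ _ _ (1021 / 1000)) => //; rewrite ?x1 ?bio ?eqxx//; lra.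
- by move=> n; apply/negP => /fk; rewrite leNgt jP.
Qed.
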